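(* Let $H\in C^\infty(\mathbb{R}^2)$ satisfy (H1') and (H2), let $U\subset\mathbb{R}^2$ be a domain, $\epsilon\in(0,1]$, and let $u^\epsilon\in C^\infty(U)$ solve $\mathscr A_H[u^\epsilon]+\epsilon\operatorname{div}[D_pH(Du^\epsilon)]=0$ in $U$. Then $[H(Du^\epsilon)]^{1/2}$ is locally Lipschitz in $U$, and at every $x\in U$ at which $[H(Du^\epsilon)]^{1/2}$ is differentiable, $$[-\det D^2u^\epsilon][\det D^2_{pp}H(Du^\epsilon)]=4\tilde\tau_H(Du^\epsilon)\langle D^2_{pp}H(Du^\epsilon)D[H(Du^\epsilon)]^{1/2},D[H(Du^\epsilon)]^{1/2}\rangle+\tilde\tau_H(Du^\epsilon)\frac{\epsilon(\operatorname{div}[D_pH(Du^\epsilon)])^2}{H(Du^\epsilon)}.$$ In particular $-\det D^2u^\epsilon\ge0$ in $U$.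
   Context: (H2): $H(0)=\min_{p}H(p)=0$. For $R\ge0$, $\lambda_H(R):=\sup_{\epsilon>0}\sup\{\lambda>0: H-\frac\lambda2|p|^2\text{ convex on }H^{-1}([0,R+\epsilon))\}$, $\Lambda_H(R):=\inf_{\epsilon>0}\inf\{\Lambda>0:\frac\Lambda2|p|^2-H\text{ convex on }H^{-1}([0,R+\epsilon))\}$; $\lambda_H(\infty)=\lim_{R\to\infty}\lambda_H(R)$, $\Lambda_H(\infty)=\lim_{R\to\infty}\Lambda_H(R)$. (H1'): $0<\lambda_H(\infty)\le\Lambda_H(\infty)<\infty$ (i.e. $H$ is strongly convex and strongly concave on $\mathbb{R}^2$). $\mathscr A_H[v]:=\sum_{i,j}H_{p_i}(Dv)H_{p_j}(Dv)v_{x_ix_j}$. $\tilde\tau_H(0)=\frac12$ and $\tilde\tau_H(p)=H(p)/\langle[D^2_{pp}H(p)]^{-1}D_pH(p),D_pH(p)\rangle$ for $p\ne0$. Convention: at points where $D_pH(Du^\epsilon)=0$ (equivalently $Du^\epsilon=0$) the quotient $(\operatorname{div}[D_pH(Du^\epsilon)])^2/H(Du^\epsilon)$ is taken to be $0$. *)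

(* Defs.v *)
From HB Require Import structures.
From mathcomp Require Import all_boot all_order all_algebra.
From mathcomp Require Import all_classical all_reals all_analysis.
Set Implicit Arguments. Unset Strict Implicit. Unset Printing Implicit Defensive.
Import Order.TTheory GRing.Theory Num.Theory.
Import numFieldNormedType.Exports.
Local Open Scope classical_set_scope.
Local Open Scope ring_scope.

Section Defs.
Variable R : realType.
Notation V := 'rV[R]_2.

Definition evec (i : 'I_2) : V := delta_mx 0 i.

Definition dotv (u v : V) : R := (u *m v^T) 0 0.
Definition sqnorm (p : V) : R := dotv p p.
Definition mxapp (A : 'M[R]_2) (v : V) : V := (A *m v^T)^T.

Definition iterD (vs : seq V) (f : V -> R) : V -> R :=
  foldr (fun v g => 'D_v g) f vs.

Definition smooth_on (U : set V) (f : V -> R) : Prop :=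
  forall (vs : seq V) (x : V), U x -> differentiable (iterD vs f) x.

Definition grad (f : V -> R) (x : V) : V := \row_i 'D_(evec i) f x.
Definition hess (f : V -> R) (x : V) : 'M[R]_2 :=
  \matrix_(i, j) 'D_(evec i) ('D_(evec j) f) x.

Definition convex_fun (f : V -> R) : Prop :=
  forall (p q : V) (t : R), 0 <= t <= 1 ->
    f (t *: p + (1 - t) *: q) <= t * f p + (1 - t) * f q.

Definition H1' (H : V -> R) : Prop :=
  exists lam Lam : R, 0 < lam /\ lam <= Lam /\
    convex_fun (fun p => H p - lam / 2 * sqnorm p) /\
    convex_fun (fun p => Lam / 2 * sqnorm p - H p).

Definition H2 (H : V -> R) : Prop := H 0 = 0 /\ forall p, 0 <= H p.

Definition domain (U : set V) : Prop := U !=set0 /\ open U /\ connected U.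

Definition AH (H v : V -> R) (x : V) : R :=
  \sum_(i < 2) \sum_(j < 2)
    grad H (grad v x) 0 i * grad H (grad v x) 0 j * hess v x i j.

Definition divDpH (H v : V -> R) (x : V) : R :=
  \sum_(i < 2) 'D_(evec i) (fun y => grad H (grad v y) 0 i) x.

Definition tauH (H : V -> R) (p : V) : R :=
  if p == 0 then 1 / 2
  else H p / dotv (mxapp (invmx (hess H p)) (grad H p)) (grad H p).

Definition locally_lipschitz_on (U : set V) (f : V -> R) : Prop :=
  forall x, U x -> exists r : R, 0 < r /\ ball x r `<=` U /\
    exists L : R, forall y z, ball x r y -> ball x r z ->
      `|f y - f z| <= L * `|y - z|.

End Defs.

(* Main.v *)
(* Write p = Du(x), q = DH(p), A = D^2 H(p), B = D^2 u(x).  The equation reads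
   <B q, q> = - eps tr(A B), and D[H(Du)] = B q.  If p <> 0, Cayley-Hamilton for
   A B gives B A B - tr(A B) B + det(A B) A^-1 = 0; pairing it with q yields
   - det(A B) <A^-1 q, q> = <A B q, B q> + eps tr(A B)^2, which is the identity
   and also shows det B <= 0.  If p = 0, then [H(Du)]^(1/2) has a minimum at x,
   so its gradient vanishes wherever it is differentiable; since it dominates
   |Du|, also B = 0 there.  Without differentiability, p = 0 still forces
   tr(A B) = 0 with A positive definite, hence det B <= 0.  The Lipschitz bound
   holds because semiconcavity of H makes H^(1/2) globally Lipschitz. *)
Require Import Defs.
From HB Require Import structures.
From mathcomp Require Import all_boot all_order all_algebra.
From mathcomp Require Import all_classical all_reals all_analysis.
From mathcomp Require Import ring lra.
Set Implicit Arguments. Unset Strict Implicit. Unset Printing Implicit Defensive.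
Import Order.TTheory GRing.Theory Num.Theory.
Import numFieldNormedType.Exports.
Local Open Scope classical_set_scope.
Local Open Scope ring_scope.

(** Closes [derive_comm]: a common value of the two mixed derivatives would lie too near two
    distinct numbers. *)
Lemma dist_halves (R : realFieldType) (a b c : R) :
  `|a - c| < `|a - b| / 2 -> `|b - c| < `|a - b| / 2 -> False.
Proof. by have := ler_distD c a b; rewrite [`|c - b|]distrC; lra. Qed.

(** * Mean values along lines and symmetry of mixed directional derivatives *)

Section DirectionalDerivatives.
Context {R : realType} {V : normedModType R}.
Implicit Types (f : V -> R) (x v w : V) (U : set V).

(** The difference quotients on both sides agree as functions of the increment, so the limits agree
    too. *)
Lemma is_derive_line {W : normedModType R} (f : V -> W) x v (t : R) :
  derivable f (t *: v + x) v ->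
  is_derive t 1 (fun s : R => f (s *: v + x)) ('D_v f (t *: v + x)).
Proof.
set F := fun h => h^-1 *: ((f \o shift (t *: v + x)) (h *: v) - f (t *: v + x)).
have E : (fun h : R => h^-1 *: (((fun s : R => f (s *: v + x)) \o shift t) (h *: 1) -
    f (t *: v + x))) = F.
  by apply/funext => h; rewrite /F /= [h *: (1 : R)]mulr1 scalerDl addrA.
by move=> df; split; rewrite /derivable /derive E.
Qed.

Lemma mean_value_line f x v (t : R) : 0 < t ->
  (forall s, 0 <= s <= t -> differentiable f (s *: v + x)) ->
  exists2 c, 0 < c < t & f (t *: v + x) - f x = 'D_v f (c *: v + x) * t.
Proof.
move=> t0 df.
have [||c] := @MVT R (fun s => f (s *: v + x)) (fun s => 'D_v f (s *: v + x)) 0 t t0.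
- move=> s; rewrite in_itv /= => /andP[s0 st]; apply: is_derive_line.
  by apply/diff_derivable/df; rewrite !ltW.
- apply: derivable_within_continuous => s; rewrite in_itv /= => st.
  have/diff_derivable/is_derive_line D := df s st.
  exact: ex_derive.
by rewrite in_itv /= => ct; rewrite scale0r add0r subr0 => E; exists c.
Qed.

Lemma derive_translate f w x v :
  'D_v (fun y => f (y + w)) x = 'D_v f (x + w).
Proof.
rewrite /derive; congr (lim (_ @ 0^')).
by apply/funext => h; rewrite /= addrA.
Qed.

Lemma differentiable_translate f w x :
  differentiable f (x + w) -> differentiable (fun y => f (y + w)) x.
Proof. by move=> df; apply: differentiable_comp. Qed.

(** Two mean value steps: along v for y |-> f(y + t w) - f(y), then along w for the derivative of f
    along v. *)
Lemma second_difference f x v w (t : R) : 0 < t ->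
  (forall a b, 0 <= a <= t -> 0 <= b <= t ->
     differentiable f (a *: v + b *: w + x) /\
     differentiable ('D_v f) (a *: v + b *: w + x)) ->
  exists a b, [/\ 0 <= a <= t, 0 <= b <= t &
    f (t *: v + t *: w + x) - f (t *: v + x) - f (t *: w + x) + f x =
    'D_w ('D_v f) (a *: v + b *: w + x) * t * t].
Proof.
move=> t0 df; have tt : 0 <= t <= t by rewrite lexx ltW.
have z0 : (0 : R) <= 0 <= t by rewrite lexx ltW.
have df1 a : 0 <= a <= t -> differentiable f (a *: v + x + t *: w).
  by move=> at_; have [+ _] := df a t at_ tt; rewrite addrAC.
have df2 a : 0 <= a <= t -> differentiable f (a *: v + x).
  by move=> at_; have [+ _] := df a 0 at_ z0; rewrite scale0r addr0.
have [] := @mean_value_line (fun y => f (y + t *: w) - f y) x v t t0.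
  move=> s st; apply: differentiableB; last exact: df2.
  exact/differentiable_translate/df1.
move=> a /andP[a0 at_]; have aI : 0 <= a <= t by rewrite !ltW.
rewrite deriveB; last 2 first.
- exact/diff_derivable/differentiable_translate/df1.
- exact/diff_derivable/df2.
rewrite derive_translate => E.
have [] := @mean_value_line ('D_v f) (a *: v + x) w t t0.
  by move=> s st; have [_] := df a s aI st; rewrite addrCA addrA.
move=> b /andP[b0 bt] E'; exists a, b; split; rewrite ?ltW //.
rewrite [t *: w + (a *: v + x)]addrC in E'.
rewrite [a *: v + b *: w + x]addrAC [a *: v + x + b *: w]addrC -E' -E.
rewrite [t *: v + t *: w + x]addrAC [t *: w + x]addrC; lra.
Qed.

Lemma near_cell x v w (U : set V) : nbhs x U ->
  exists2 t : R, 0 < t & forall a b, 0 <= a <= t -> 0 <= b <= t ->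
     U (a *: v + b *: w + x).
Proof.
move=> /nbhs_ballP[r /= r0 rU]; pose N := `|v| + `|w| + 1.
have N0 : 0 < N by rewrite ltr_wpDl // addr_ge0.
(* With this side length the displacement is at most r/2; the 1 in [N] keeps it positive when v = w
   = 0. *)
exists (r / N / 2); first by rewrite !divr_gt0.
move=> a b /andP[a0 at_] /andP[b0 bt]; apply: rU.
rewrite -ball_normE /= opprD addrCA subrr addr0 normrN.
apply: (le_lt_trans (ler_normD _ _)); rewrite !normrZ !ger0_norm //.
have e : r / N / 2 * N = r / 2 by field; rewrite gt_eqF.
have h1 : a * `|v| <= r / N / 2 * `|v| by rewrite ler_wpM2r.
have h2 : b * `|w| <= r / N / 2 * `|w| by rewrite ler_wpM2r.
have h3 : r / N / 2 * `|v| + r / N / 2 * `|w| <= r / N / 2 * N.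
  by rewrite -mulrDr ler_wpM2l ?lerDl // !divr_ge0 // ltW.
lra.
Qed.

(** The second difference is symmetric in v and w, so in every small cell at x the two mixed
    derivatives share a value, possibly at different points. If they differed at x, continuity would
    keep them apart on a small cell. *)
Theorem derive_comm f x v w :
  (\forall y \near x, differentiable f y /\ differentiable ('D_v f) y /\
     differentiable ('D_w f) y) ->
  {for x, continuous ('D_w ('D_v f))} -> {for x, continuous ('D_v ('D_w f))} ->
  'D_w ('D_v f) x = 'D_v ('D_w f) x.
Proof.
move=> df cwv cvw; apply: contrapT => /eqP; rewrite -subr_eq0 -normr_gt0.
set d := `|_| => d0.
have d20 : 0 < d / 2 by rewrite divr_gt0.
have n1 : nbhs x [set y | `|'D_w ('D_v f) x - 'D_w ('D_v f) y| < d / 2].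
  by move/cvgrPdist_lt : cwv => /(_ _ d20).
have n2 : nbhs x [set y | `|'D_v ('D_w f) x - 'D_v ('D_w f) y| < d / 2].
  by move/cvgrPdist_lt : cvw => /(_ _ d20).
have [t t0 tU] := @near_cell x v w _ (filterI df (filterI n1 n2)).
have [|a [b [aI bI E]]] := @second_difference f x v w t t0.
  by move=> a b aI bI; have [[? [? ?]] _] := tU a b aI bI.
have [|b' [a' [bI' aI' E']]] := @second_difference f x w v t t0.
  move=> b' a' aI' bI'; have [[? [? ?]] _] := tU a' b' bI' aI'.
  by rewrite [b' *: w + _]addrC.
(* Both sides are the second difference divided by t^2. *)
have e : 'D_w ('D_v f) (a *: v + b *: w + x) = 'D_v ('D_w f) (b' *: w + a' *: v + x).
  have tn : t != 0 by rewrite gt_eqF.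
  apply: (mulIf tn).
  apply: (mulIf tn).
  apply: (etrans (esym E)).
  apply: (etrans _ E').
  rewrite [t *: w + t *: v]addrC.
  by congr (_ + _); rewrite addrAC.
have [_ [/= h1 _]] := tU _ _ aI bI.
have [_ [_ /= h2]] := tU _ _ aI' bI'.
rewrite [a' *: v + _]addrC -e in h2.
exact: dist_halves h1 h2.
Qed.

Lemma derive_right_cvg f x v : derivable f x v ->
  h^-1 * (f (h *: v + x) - f x) @[h --> 0^'+] --> 'D_v f x.
Proof. exact: cvg_dnbhs_at_right. Qed.

Lemma derive_left_cvg f x v : derivable f x v ->
  h^-1 * (f (h *: v + x) - f x) @[h --> 0^'-] --> 'D_v f x.
Proof. exact: cvg_dnbhs_at_left. Qed.

(** At a minimum the quotients are nonpositive from the left and nonnegative from the right. *)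
Lemma derive_at_min f x v : derivable f x v -> (forall y, f x <= f y) ->
  'D_v f x = 0.
Proof.
move=> df fmin; apply/eqP; rewrite eq_le; apply/andP; split.
- have L := derive_left_cvg df; apply: (cvgr_to_le L _); near=> h.
  by rewrite mulr_le0_ge0 ?subr_ge0 // invr_le0 ltW.
- have L := derive_right_cvg df; apply: (cvgr_to_ge L _); near=> h.
  by rewrite mulr_ge0 ?subr_ge0 // invr_ge0 ltW.
Unshelve. all: by end_near. Qed.

End DirectionalDerivatives.

(** * Coordinates, gradients and Hessians in the plane *)

Section Plane.
Context {R : realType}.
Notation V := 'rV[R]_2.
Implicit Types (f H u : V -> R) (p q v w x : V) (U : set V) (A B : 'M[R]_2).

Lemma sum_ord2 (M : nmodType) (F : 'I_2 -> M) : \sum_i F i = F 0 + F 1.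
Proof. by rewrite !big_ord_recl big_ord0 addr0; congr (_ + F _); exact/val_inj. Qed.

Lemma dotvE v w : dotv v w = v 0 0 * w 0 0 + v 0 1 * w 0 1.
Proof. by rewrite /dotv mxE sum_ord2 !mxE. Qed.

Lemma mxappE A v i : mxapp A v 0 i = A i 0 * v 0 0 + A i 1 * v 0 1.
Proof. by rewrite /mxapp !mxE sum_ord2 !mxE. Qed.

Lemma det2 A : \det A = A 0 0 * A 1 1 - A 0 1 * A 1 0.
Proof.
rewrite (expand_det_row A 0) sum_ord2 /cofactor !det_mx11 !mxE /=.
rewrite addn0 add0n expr0 expr1 mul1r mulN1r mulrN.
by do 3 f_equal; try f_equal; apply/val_inj.
Qed.

Lemma eq_rV2 v w : v 0 0 = w 0 0 -> v 0 1 = w 0 1 -> v = w.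
Proof.
move=> e0 e1; apply/rowP => -[[|[|//]] lti].
  by rewrite -(_ : 0 = Ordinal lti) //; exact/val_inj.
by rewrite -(_ : 1 = Ordinal lti) //; exact/val_inj.
Qed.

Lemma sum_evec v : v = v 0 0 *: evec R 0 + v 0 1 *: evec R 1.
Proof. by apply: eq_rV2; rewrite !mxE /= ?mulr1 ?mulr0 ?addr0 ?add0r. Qed.

Lemma derive_grad f x v : differentiable f x -> 'D_v f x = dotv (grad f x) v.
Proof.
move=> df; rewrite dotvE !mxE !deriveE // {1}[v]sum_evec linearD !linearZ.
by rewrite mulrC [X in _ + X]mulrC.
Qed.

Lemma differentiable_rV2 (W : normedModType R) (g0 g1 : W -> R) (x : W) :
  differentiable g0 x -> differentiable g1 x ->
  differentiable (fun y => g0 y *: evec R 0 + g1 y *: evec R 1 : V) x.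
Proof. by move=> d0 d1; apply: differentiableD; exact: differentiableZl. Qed.

Lemma gradE f : grad f = fun x => 'D_(evec R 0) f x *: evec R 0 + 'D_(evec R 1) f x *: evec R 1.
Proof. by apply/funext => x; rewrite [LHS]sum_evec !mxE. Qed.

Lemma coord_le_norm v i : `|v 0 i| <= `|v|.
Proof.
rewrite [leRHS]/Num.Def.normr /= mx_normrE.
exact: (@le_bigmax _ _ _ _ (fun ij : 'I_1 * 'I_2 => `|v ij.1 ij.2|) (0, i)).
Qed.

Lemma smooth_differentiable U f x : smooth_on U f -> U x -> differentiable f x.
Proof. by move=> /(_ [::]); exact. Qed.

(** [iterD] applies the last direction of its list first, so a preliminary derivative along v
    amounts to appending v. *)
Lemma smooth_derive U f v : smooth_on U f -> smooth_on U ('D_v f).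
Proof.
move=> sf vs x Ux; have := sf (rcons vs v) x Ux.
by rewrite /Defs.iterD -cats1 foldr_cat.
Qed.

Lemma smooth_derive_differentiable U f v x :
  smooth_on U f -> U x -> differentiable ('D_v f) x.
Proof. by move=> /(smooth_derive v); exact: smooth_differentiable. Qed.

Lemma differentiable_grad U f x : smooth_on U f -> U x -> differentiable (grad f) x.
Proof.
move=> sf Ux; rewrite gradE.
by apply: differentiable_rV2; exact: smooth_derive_differentiable sf Ux.
Qed.

Lemma derive_gradE U f x v i : smooth_on U f -> U x ->
  ('D_v (grad f) x) 0 i = 'D_v (fun y => grad f y 0 i) x.
Proof.
move=> sf Ux; rewrite derive_mx ?mxE //.
exact/diff_derivable/(differentiable_grad sf Ux).
Qed.

Lemma hess_sym U f x i j : smooth_on U f -> open U -> U x ->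
  hess f x i j = hess f x j i.
Proof.
move=> sf oU Ux; rewrite !mxE; apply: derive_comm.
- have : nbhs x U by exact: open_nbhs_nbhs.
  apply: filterS => y Uy; split; first exact: smooth_differentiable sf Uy.
  by split; exact: smooth_derive_differentiable sf Uy.
- apply: differentiable_continuous.
  by apply: smooth_derive_differentiable Ux; apply: smooth_derive.
- apply: differentiable_continuous.
  by apply: smooth_derive_differentiable Ux; apply: smooth_derive.
Qed.

Lemma derive_comp_grad U u H x v : smooth_on U u -> U x ->
  differentiable H (grad u x) ->
  'D_v (fun y => H (grad u y)) x = dotv (grad H (grad u x)) ('D_v (grad u) x).
Proof.
move=> su Ux dH; have du := differentiable_grad su Ux.
rewrite -derive_grad // !deriveE //; last exact: differentiable_comp.
have E := diff_comp du dH.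
exact: (congr1 (fun g => g v) E).
Qed.

(** * Local Lipschitz bounds for smooth functions *)

Lemma ball_segment (W : normedModType R) (x y z : W) (r s : R) : 0 <= s <= 1 ->
  ball x r y -> ball x r z -> ball x r (s *: (z - y) + y).
Proof.
rewrite -ball_normE /= => /andP[s0 s1] xy xz.
have -> : x - (s *: (z - y) + y) = s *: (x - z) + (1 - s) *: (x - y).
  rewrite scalerBl scale1r [RHS]addrCA -scalerBr opprB [x - z + _]addrC addrA subrK.
  by rewrite opprD addrCA addrC -scalerN opprB.
have h := ler_normD (s *: (x - z)) ((1 - s) *: (x - y)).
rewrite !normrZ ger0_norm // [`|1 - s|]ger0_norm ?subr_ge0 // in h.
set m := Num.max `|x - z| `|x - y|.
have m1 : `|x - z| <= m by rewrite le_max lexx.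
have m2 : `|x - y| <= m by rewrite le_max lexx orbT.
have mr : m < r by rewrite gt_max xz xy.
apply: (le_lt_trans h); apply: le_lt_trans mr.
have -> : m = s * m + (1 - s) * m by ring.
by apply: lerD; rewrite ler_wpM2l // subr_ge0.
Qed.

(** Continuity bounds both partial derivatives near x, and balls are convex. Stating this for all
    small radii lets [sqrt_grad_lipschitz] choose one ball for both components of Du. *)
Lemma smooth_locally_lipschitz U f x : smooth_on U f -> open U -> U x ->
  \forall r \near (0 : R)^'+, ball x r `<=` U /\
    exists2 L : R, 0 <= L & forall y z, ball x r y -> ball x r z ->
      `|f y - f z| <= L * `|y - z|.
Proof.
move=> sf oU Ux.
have bnd v : nbhs x [set y | `|'D_v f y| < `|'D_v f x| + 1].
  have /differentiable_continuous c := smooth_derive_differentiable v sf Ux.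
  move/cvgrPdist_lt : c => /(_ 1 ltr01); apply: filterS => y /= d.
  by rewrite -ltrBlDl; apply: le_lt_trans d; rewrite distrC; exact: lerB_dist.
have nU : nbhs x U by exact: open_nbhs_nbhs.
have nb : nbhs x (U `&` ([set y | `|'D_(evec R 0) f y| < `|'D_(evec R 0) f x| + 1]
                     `&` [set y | `|'D_(evec R 1) f y| < `|'D_(evec R 1) f x| + 1])).
  by apply: filterI => //; apply: filterI; exact: bnd.
have [r0 /= r00 hr0] := (nbhs_ballP _ _).1 nb.
near=> r; have rr0 : r < r0 by near: r; exact: nbhs_right_lt.
have sub : ball x r `<=` ball x r0 by apply: le_ball; exact: ltW.
split=> [y /sub/hr0[]//|].
set L0 := `|'D_(evec R 0) f x| + 1 in hr0; set L1 := `|'D_(evec R 1) f x| + 1 in hr0.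
exists (L0 + L1); first by rewrite !addr_ge0.
move=> y z xy xz.
have inb (s : R) : 0 <= s <= 1 -> ball x r (s *: (y - z) + z) by move=> ?; exact: ball_segment.
(* The mean value theorem on the segment from z to y, which stays in the ball. *)
have [//||c /andP[c0 c1]] := @mean_value_line R _ f z (y - z) 1.
  by move=> s /inb /sub/hr0[Us _]; exact: smooth_differentiable sf Us.
rewrite scale1r subrK mulr1 => ->.
have /inb/sub/hr0[Uc /= [b0 b1]] : 0 <= c <= 1 by rewrite !ltW.
rewrite derive_grad ?dotvE ?[grad _ _ _ _]mxE; last exact: smooth_differentiable sf Uc.
have n0 := coord_le_norm (y - z) 0; have n1 := coord_le_norm (y - z) 1.
apply: (le_trans (ler_normD _ _)); rewrite !normrM mulrDl.
apply: lerD.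
- by apply: (ler_pM (normr_ge0 _) (normr_ge0 _) _ n0); exact: (ltW b0).
- by apply: (ler_pM (normr_ge0 _) (normr_ge0 _) _ n1); exact: (ltW b1).
Unshelve. all: by end_near. Qed.

(** * Quantitative convexity and concavity *)

Lemma sqnormE v : sqnorm v = v 0 0 ^+ 2 + v 0 1 ^+ 2.
Proof. by rewrite /sqnorm dotvE !expr2. Qed.

Lemma sqnorm_ge0 v : 0 <= sqnorm v.
Proof. by rewrite sqnormE addr_ge0 ?sqr_ge0. Qed.

Lemma sqnorm_gt0 v : v != 0 -> 0 < sqnorm v.
Proof.
rewrite lt_neqAle sqnorm_ge0 andbT; apply: contra; rewrite eq_sym sqnormE.
rewrite paddr_eq0 ?sqr_ge0 // !sqrf_eq0 => /andP[/eqP v0 /eqP v1].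
by apply/eqP/eq_rV2; rewrite ?v0 ?v1 mxE.
Qed.

Lemma sqnormZ (t : R) v : sqnorm (t *: v) = t ^+ 2 * sqnorm v.
Proof. by rewrite !sqnormE !mxE; ring. Qed.

(** Converts convexity of H minus a quadratic, or of a quadratic minus H, into an inequality for H
    with an explicit error. *)
Lemma sqnorm_convex_defect p q (t : R) :
  sqnorm (t *: p + (1 - t) *: q) =
  t * sqnorm p + (1 - t) * sqnorm q - t * (1 - t) * sqnorm (p - q).
Proof. by rewrite !sqnormE !mxE; ring. Qed.

(* Halving the optimal constant lam / 2 spares the limit in the quadratic
   term of the difference quotients. *)
Lemma strongly_convex_tangent H (lam : R) p v : 0 < lam ->
  convex_fun (fun p => H p - lam / 2 * sqnorm p) -> derivable H p v ->
  'D_v H p + lam / 4 * sqnorm v <= H (p + v) - H p.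
Proof.
move=> lam0 cH dH; have L := derive_right_cvg dH.
rewrite -lerBrDr; apply: (cvgr_to_le L); near=> h.
have h0 : 0 < h by near: h; exact: nbhs_right_gt.
have h2 : h < 1 / 2 by near: h; apply: nbhs_right_lt; lra.
have hI : 0 <= h <= 1 by apply/andP; split; lra.
have := cH (p + v) p h hI; rewrite sqnorm_convex_defect.
have -> : h *: (p + v) + (1 - h) *: p = h *: v + p.
  by rewrite scalerDr scalerBl scale1r addrC addrA subrK addrC.
rewrite [p + v - p]addrC addKr => c.
have d : H (h *: v + p) - H p <=
    h * (H (p + v) - H p - lam / 2 * (1 - h) * sqnorm v) by lra.
have e : lam / 4 * sqnorm v <= lam / 2 * (1 - h) * sqnorm v.
  by rewrite ler_wpM2r ?sqnorm_ge0 //; nra.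
rewrite mulrC ler_pdivrMr // mulrC; apply: (le_trans d).
by rewrite ler_pM2l // lerB.
Unshelve. all: by end_near. Qed.

(** If H grew too fast from p to q, semiconcavity would make it negative at a point beyond p on the
    line through q. Optimizing over that point gives H(q) <= (a + b)^2 with a = H(p)^(1/2). *)
Lemma sqrt_lipschitz H (Lam b : R) p q : 0 <= Lam -> 0 <= b ->
  convex_fun (fun p => Lam / 2 * sqnorm p - H p) -> (forall p, 0 <= H p) ->
  Lam / 2 * sqnorm (q - p) <= b ^+ 2 ->
  Num.sqrt (H q) <= Num.sqrt (H p) + b.
Proof.
move=> Lam0 b0 cH H0 db; set a := Num.sqrt (H p).
have a0 : 0 <= a by exact: sqrtr_ge0.
have Hp : H p = a ^+ 2 by rewrite sqr_sqrtr.
(* Here p is the convex combination of q and r = p - s (q - p) with weight t = s / (1 + s) on q. The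
   term H(r) >= 0 is dropped, and t (1 - t) (1 + s)^2 = s. *)
have key (s : R) : 0 < s -> s * H q <= (1 + s) * a ^+ 2 + s * (1 + s) * b ^+ 2.
  move=> s0; set r := p - s *: (q - p); set t := s / (1 + s).
  have s1 : 1 + s != 0 by rewrite gt_eqF // addr_gt0.
  have t1 : t * (1 + s) = s by rewrite /t divfK.
  have tI : 0 <= t <= 1.
    have s0' := ltW s0; rewrite /t divr_ge0 ?addr_ge0 //=.
    by rewrite ler_pdivrMr ?addr_gt0 // mul1r lerDr.
  have := cH q r t tI; rewrite sqnorm_convex_defect.
  have -> : t *: q + (1 - t) *: r = p.
    by apply: eq_rV2; rewrite !mxE /t; field.
  have -> : q - r = (1 + s) *: (q - p) by apply: eq_rV2; rewrite !mxE; ring.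
  rewrite sqnormZ Hp => c; have Hr := H0 r.
  have [t0 t1'] := andP tI.
  have c1 : t * H q <= a ^+ 2 + Lam / 2 * (t * (1 - t) * ((1 + s) ^+ 2 * sqnorm (q - p))).
    have : 0 <= (1 - t) * H r by rewrite mulr_ge0 // subr_ge0.
    move: c; set X := sqnorm _; set Y := sqnorm _; set Z := sqnorm _; lra.
  have e : t * (1 - t) * ((1 + s) ^+ 2 * sqnorm (q - p)) = s * sqnorm (q - p).
    by rewrite /t; field.
  rewrite e in c1.
  have c2 : t * H q <= a ^+ 2 + s * b ^+ 2.
    apply: (le_trans c1); rewrite lerD2l mulrCA ler_wpM2l //; exact: ltW.
  have : (1 + s) * (t * H q) <= (1 + s) * (a ^+ 2 + s * b ^+ 2).
    by rewrite ler_wpM2l // addr_ge0 // ltW.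
  by rewrite mulrA [(1 + s) * t]mulrC t1 mulrDr mulrA [(1 + s) * s]mulrC.
apply/ler_addgt0Pr => e e0.
have ae : 0 < a + e by rewrite ltr_wpDl.
have be : 0 < b + e by rewrite ltr_wpDl.
have abe : 0 <= a + b + e by rewrite !addr_ge0 // ltW.
rewrite -[leRHS]ger0_norm // -sqrtr_sqr ler_wsqrtr //.
(* The optimal s is a / b; adding e to both terms keeps it defined and positive when a or b is 0. *)
have := key _ (divr_gt0 ae be) => k.
have k' : (a + e) * (b + e) * H q <= (b + e) * (a + b + e + e) * a ^+ 2
    + (a + e) * (a + b + e + e) * b ^+ 2.
  have := ler_wpM2r (sqr_ge0 (b + e)) k.
  have -> : (a + e) / (b + e) * H q * (b + e) ^+ 2 = (a + e) * (b + e) * H q.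
    by field; rewrite gt_eqF.
  suff -> : ((1 + (a + e) / (b + e)) * a ^+ 2
    + (a + e) / (b + e) * (1 + (a + e) / (b + e)) * b ^+ 2) * (b + e) ^+ 2 =
    (b + e) * (a + b + e + e) * a ^+ 2
    + (a + e) * (a + b + e + e) * b ^+ 2 by [].
  by field; rewrite gt_eqF.
have ab : 0 < (a + e) * (b + e) by rewrite mulr_gt0.
rewrite -(ler_pM2l ab); apply: (le_trans k').
rewrite -subr_ge0.
(* The slack expands into a sum of visibly nonnegative terms. *)
have -> : (a + e) * (b + e) * (a + b + e) ^+ 2 -
   ((b + e) * (a + b + e + e) * a ^+ 2 + (a + e) * (a + b + e + e) * b ^+ 2) =
   (a + e) * (b + e) * (e ^+ 2 + e * (a + b)) + a * (b + e) ^+ 2 * e +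
   b * (a + e) ^+ 2 * e by ring.
have e1 := ltW e0; have ae1 := ltW ae; have be1 := ltW be.
by rewrite !addr_ge0 // ?mulr_ge0 ?addr_ge0 ?mulr_ge0 ?sqr_ge0 // addr_ge0.
Qed.

Lemma dotvC v w : dotv v w = dotv w v.
Proof. by rewrite !dotvE mulrC [X in _ + X]mulrC. Qed.

Lemma dot0v v : dotv 0 v = 0.
Proof. by rewrite /dotv mul0mx mxE. Qed.

Lemma mxapp0 A : mxapp A 0 = 0.
Proof. by rewrite /mxapp trmx0 mulmx0 trmx0. Qed.

Lemma dotvNr v w : dotv v (- w) = - dotv v w.
Proof. by rewrite !dotvE !mxE; ring. Qed.

Lemma dotvZr (t : R) v w : dotv v (t *: w) = t * dotv v w.
Proof. by rewrite !dotvE !mxE; ring. Qed.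

Lemma quadratic_form_mul (t : R) A v :
  dotv (mxapp A (t *: v)) (t *: v) = t ^+ 2 * dotv (mxapp A v) v.
Proof. by rewrite !dotvE !mxappE !mxE; ring. Qed.

(** The tangent inequalities at p and at p + v are added; each contributes lam / 4. *)
Lemma gradient_strongly_monotone H (lam : R) p v : 0 < lam ->
  convex_fun (fun p => H p - lam / 2 * sqnorm p) ->
  differentiable H p -> differentiable H (p + v) ->
  lam / 2 * sqnorm v <= 'D_v H (p + v) - 'D_v H p.
Proof.
move=> lam0 cH d1 d2.
have h1 := strongly_convex_tangent lam0 cH (diff_derivable d1 : derivable H p v).
have h2 := strongly_convex_tangent lam0 cH (diff_derivable d2 : derivable H (p + v) (- v)).
move: h2; rewrite addrK -scaleN1r sqnormZ scaleN1r derive_grad // dotvNr -derive_grad //.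
move: h1; set a := 'D_v _ _; set b := 'D_v _ _; set s := sqnorm _.
set c := H _; set d := H _; lra.
Qed.

Lemma derive2_hess H p v : smooth_on setT H ->
  'D_v ('D_v H) p = dotv (mxapp (hess H p) v) v.
Proof.
move=> sH.
have dH i : differentiable ('D_(evec R i) H) p.
  exact: smooth_derive_differentiable sH _.
have dvi i j : derivable ('D_(evec R i) H) p (evec R j) by exact/diff_derivable/dH.
have E : 'D_v H = v 0 0 *: 'D_(evec R 0) H + v 0 1 *: 'D_(evec R 1) H.
  apply/funext => y; rewrite derive_grad; last exact: smooth_differentiable sH _.
  by rewrite dotvE !mxE mulrC [X in _ + X]mulrC.
rewrite derive_grad; last exact: smooth_derive_differentiable sH _.
have De i : 'D_(evec R i) ('D_v H) p = mxapp (hess H p) v 0 i.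
  rewrite E deriveD ?deriveZ //; try exact: derivableZ.
  by rewrite mxappE; congr (_ + _); rewrite [hess _ _ _ _]mxE; exact: mulrC.
by congr (dotv _ v); apply/rowP => i; rewrite mxE De.
Qed.

(** Gradient monotonicity for the increment h v, divided by h^2, passes to the limit as h tends to 0
    from the right. *)
Lemma hess_coercive H (lam : R) p v : 0 < lam -> smooth_on setT H ->
  convex_fun (fun p => H p - lam / 2 * sqnorm p) ->
  lam / 2 * sqnorm v <= dotv (mxapp (hess H p) v) v.
Proof.
move=> lam0 sH cH; rewrite -derive2_hess //.
have dH q : differentiable H q by exact: smooth_differentiable sH _.
have d2 : derivable ('D_v H) p v.
  by apply/diff_derivable/(smooth_derive_differentiable v sH).
have L := derive_right_cvg d2.
apply: (cvgr_to_ge L); near=> h.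
have h0 : 0 < h by near: h; exact: nbhs_right_gt.
have := gradient_strongly_monotone lam0 cH (dH p) (dH (p + h *: v)).
rewrite sqnormZ !(derive_grad (h *: v)) // !dotvZr -!derive_grad //.
rewrite [p + _]addrC -mulrBr expr2 => m.
rewrite ler_pdivlMl // -(ler_pM2l h0); apply: le_trans m.
have -> : h * (h * (lam / 2 * sqnorm v)) = lam / 2 * (h * h * sqnorm v) by ring.
exact: lexx.
Unshelve. all: by end_near. Qed.

(** * Two-by-two matrices: positivity, determinant and trace *)

Lemma posdef_coef A : (forall v, v != 0 -> 0 < dotv (mxapp A v) v) ->
  0 < A 0 0 /\ (A 0 1 + A 1 0) ^+ 2 < 4 * (A 0 0 * A 1 1).
Proof.
move=> pA.
have nz (a b : R) : a *: evec R 0 + b *: evec R 1 = 0 -> a = 0 /\ b = 0.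
  by move=> /rowP e; have := e 0; have := e 1;
     rewrite !mxE /= !mulr1 !mulr0 addr0 add0r.
have val (a b : R) : (a != 0) || (b != 0) ->
    0 < A 0 0 * a ^+ 2 + (A 0 1 + A 1 0) * (a * b) + A 1 1 * b ^+ 2.
  move=> ab; have := pA (a *: evec R 0 + b *: evec R 1).
  rewrite dotvE !mxappE !mxE /= !mulr1 !mulr0 addr0 add0r => h.
  have -> : A 0 0 * a ^+ 2 + (A 0 1 + A 1 0) * (a * b) + A 1 1 * b ^+ 2 =
    (A 0 0 * a + A 0 1 * b) * a + (A 1 0 * a + A 1 1 * b) * b by ring.
  apply: h; apply: contraL ab => /eqP/nz[-> ->]; by rewrite eqxx.
have A0 : 0 < A 0 0.
  have := val 1 0; rewrite oner_neq0 => /(_ isT).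
  by rewrite expr1n mulr1 mulr0 expr0n !mulr0 !addr0.
have nz2 : 2 * A 0 0 != 0 by rewrite mulf_neq0 // gt_eqF.
(* The form sees the off-diagonal entries only through their sum. This vector, from completing the
   square, gives it the value A00 (4 A00 A11 - (A01 + A10)^2). *)
split=> //; have := val (- (A 0 1 + A 1 0)) (2 * A 0 0).
rewrite nz2 orbT => /(_ isT).
have -> : A 0 0 * (- (A 0 1 + A 1 0)) ^+ 2 +
   (A 0 1 + A 1 0) * (- (A 0 1 + A 1 0) * (2 * A 0 0)) + A 1 1 * (2 * A 0 0) ^+ 2 =
   A 0 0 * (4 * (A 0 0 * A 1 1) - (A 0 1 + A 1 0) ^+ 2) by ring.
by rewrite pmulr_rgt0 // subr_gt0.
Qed.

Lemma posdef_det A : (forall v, v != 0 -> 0 < dotv (mxapp A v) v) -> 0 < \det A.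
Proof.
move=> /posdef_coef[_]; rewrite det2.
(* 4 A01 A10 = (A01 + A10)^2 - (A01 - A10)^2. *)
by have := sqr_ge0 (A 0 1 - A 1 0); nra.
Qed.

Lemma mxapp_invmx A v : \det A != 0 -> mxapp A (mxapp (invmx A) v) = v.
Proof.
move=> dA; have uA : A \in unitmx by rewrite unitmxE unitfE.
by rewrite /mxapp trmxK mulmxA mulmxV // mul1mx trmxK.
Qed.

Lemma mxtrace2 A B : \tr (A *m B) =
  A 0 0 * B 0 0 + A 0 1 * B 1 0 + (A 1 0 * B 0 1 + A 1 1 * B 1 1).
Proof. by rewrite /mxtrace sum_ord2 !mxE !sum_ord2. Qed.

(* Cayley-Hamilton for A *m B, multiplied by invmx A on the right and B on
   the left: B A B - tr(A B) B + det(A B) A^-1 = 0. *)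
Lemma cayley_hamilton_dot A B q : \det A != 0 -> B 0 1 = B 1 0 ->
  - \det B * \det A * dotv (mxapp (invmx A) q) q =
  dotv (mxapp A (mxapp B q)) (mxapp B q) - \tr (A *m B) * dotv (mxapp B q) q.
Proof.
move=> dA sB; have := mxapp_invmx q dA; set w := mxapp _ q => <-.
by rewrite mxtrace2 !det2 !dotvE !mxappE sB; ring.
Qed.

(** With B = (x, y; y, z), a and c the diagonal of A and b = A01 + A10, zero trace reads a x + c z =
    - b y. Then 4 a c x z <= (a x + c z)^2 = b^2 y^2 <= 4 a c y^2, and 4 a c > 0 cancels. *)
Lemma trace0_det_le0 A B : (forall v, v != 0 -> 0 < dotv (mxapp A v) v) ->
  B 0 1 = B 1 0 -> \tr (A *m B) = 0 -> \det B <= 0.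
Proof.
move=> /posdef_coef[A0 dA] sB; rewrite mxtrace2 det2 sB => tr0.
set a := A 0 0 in A0 dA tr0; set c := A 1 1 in dA tr0.
set x := B 0 0 in tr0 *; set z := B 1 1 in tr0 *; set y := B 1 0 in tr0 *.
set b := A 0 1 + A 1 0 in dA.
have e : a * x + c * z = - b * y by rewrite /b; lra.
have ac : 0 < a * c by have := sqr_ge0 b; lra.
have h1 : 4 * (a * c) * (x * z) <= (b * y) ^+ 2.
  have -> : (b * y) ^+ 2 = (a * x + c * z) ^+ 2 by rewrite e; ring.
  by rewrite -subr_ge0 (_ : _ - _ = (a * x - c * z) ^+ 2) ?sqr_ge0 //; ring.
have h2 : (b * y) ^+ 2 <= 4 * (a * c) * y ^+ 2.
  by rewrite exprMn ler_wpM2r ?sqr_ge0 // ltW.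
have h3 : 0 < 4 * (a * c) by lra.
by rewrite subr_le0 -expr2 -(ler_pM2l h3) (le_trans h1).
Qed.

(** * Chain rules for H(Du), its square root and the divergence term *)

Lemma grad_coord f i : (fun y => grad f y 0 i) = 'D_(evec R i) f.
Proof. by apply/funext => y; rewrite mxE. Qed.

Lemma derive_grad_hess U u x i : smooth_on U u -> U x ->
  'D_(evec R i) (grad u) x = row i (hess u x).
Proof.
move=> su Ux; apply/rowP => j; rewrite (derive_gradE _ _ su Ux) grad_coord.
by rewrite [RHS]mxE [RHS]mxE.
Qed.

Lemma divDpH_trace U H u x : smooth_on setT H -> smooth_on U u -> U x ->
  divDpH H u x = \tr (hess H (grad u x) *m hess u x).
Proof.
move=> sH su Ux; rewrite mxtrace2 /divDpH sum_ord2.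
have D i : 'D_(evec R i) (fun y => grad H (grad u y) 0 i) x =
    dotv (grad ('D_(evec R i) H) (grad u x)) (row i (hess u x)).
  have -> : (fun y => grad H (grad u y) 0 i) = fun y => 'D_(evec R i) H (grad u y).
    by apply/funext => y; rewrite mxE.
  have dDH : differentiable ('D_(evec R i) H) (grad u x).
    exact: smooth_derive_differentiable sH _.
  by rewrite -(derive_grad_hess i su Ux); exact: derive_comp_grad su Ux dDH.
have E i j : grad ('D_(evec R i) H) (grad u x) 0 j = hess H (grad u x) j i.
  by rewrite [LHS]mxE [RHS]mxE.
have F i j : row i (hess u x) 0 j = hess u x i j by rewrite [LHS]mxE.
have G i : dotv (grad ('D_(evec R i) H) (grad u x)) (row i (hess u x)) =
    hess H (grad u x) 0 i * hess u x i 0 + hess H (grad u x) 1 i * hess u x i 1.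
  by rewrite dotvE (E i 0) (E i 1) (F i 0) (F i 1).
apply: (etrans (congr2 _ (etrans (D 0) (G 0)) (etrans (D 1) (G 1)))).
by move: (hess H _) (hess u x) => A B; ring.
Qed.

Lemma AH_dot H u x :
  AH H u x = dotv (mxapp (hess u x) (grad H (grad u x))) (grad H (grad u x)).
Proof.
rewrite /AH sum_ord2 !sum_ord2 dotvE !mxappE.
by move: (grad H _) (hess u x) => q B; ring.
Qed.

Lemma grad_comp_grad U H u x : smooth_on setT H -> smooth_on U u -> U x ->
  grad (fun y => H (grad u y)) x = mxapp (hess u x) (grad H (grad u x)).
Proof.
move=> sH su Ux; 
have dH : differentiable H (grad u x) by exact: smooth_differentiable sH _.
have F i j : row i (hess u x) 0 j = hess u x i j by rewrite [LHS]mxE.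
apply/rowP => i; rewrite [LHS]mxE.
apply: (etrans (derive_comp_grad _ su Ux dH)).
by rewrite (derive_grad_hess i su Ux) mxappE dotvE !F; congr (_ + _); exact: mulrC.
Qed.

Lemma derive_sqr f x v : derivable f x v ->
  'D_v (fun y => f y ^+ 2) x = 2 * f x * 'D_v f x.
Proof.
move=> df; have -> : (fun y => f y ^+ 2) = f * f by apply/funext => y; rewrite expr2.
by rewrite deriveM // /GRing.scale /=; ring.
Qed.

(** Differentiates the square of the root by the product rule, never the root function itself, so
    zeros of f are allowed. *)
Lemma grad_sqrt f x : (forall y, 0 <= f y) ->
  differentiable (fun y => Num.sqrt (f y)) x ->
  (2 * Num.sqrt (f x)) *: grad (fun y => Num.sqrt (f y)) x = grad f x.
Proof.
move=> f0 ds.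
have E : (fun y => Num.sqrt (f y) ^+ 2) = f by apply/funext => y; rewrite sqr_sqrtr.
apply/rowP => i; rewrite [LHS]mxE [grad _ _ _ _]mxE [RHS]mxE.
apply: (etrans (esym (derive_sqr (diff_derivable ds)))).
by rewrite E.
Qed.

(** Both functions vanish at x, so the bound holds for the difference quotients and survives the
    limit. It carries a vanishing derivative from H(Du)^(1/2) to the partial derivatives of u. *)
Lemma derive_dominated f (g : V -> R) x v (C : R) : derivable f x v -> derivable g x v ->
  f x = 0 -> g x = 0 -> (forall y, `|f y| <= C * `|g y|) ->
  `|'D_v f x| <= C * `|'D_v g x|.
Proof.
move=> df dg f0 g0 fg.
have cf : `|h^-1 * (f (h *: v + x) - f x)| @[h --> 0^'+] --> `|'D_v f x|.
  by apply: cvg_norm; exact: derive_right_cvg.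
have cg : C * `|h^-1 * (g (h *: v + x) - g x)| @[h --> 0^'+] --> C * `|'D_v g x|.
  by apply: cvgMl_tmp; apply: cvg_norm; exact: derive_right_cvg.
apply: (ler_cvg_to cf cg); near=> h.
by rewrite f0 g0 !subr0 !normrM mulrCA ler_wpM2l.
Unshelve. all: by end_near. Qed.

End Plane.

(** * Strongly convex H with minimum 0 at the origin, composed with Du *)

Section StronglyConvex.
Context {R : realType} (H : 'rV[R]_2 -> R) (lam Lam : R).
Notation V := 'rV[R]_2.
Hypotheses (sH : smooth_on setT H) (lam0 : 0 < lam) (lamLam : lam <= Lam).
Hypotheses (cH : convex_fun (fun p => H p - lam / 2 * sqnorm p))
  (CH : convex_fun (fun p => Lam / 2 * sqnorm p - H p)).
Hypotheses (H0 : H 0 = 0) (Hge0 : forall p, 0 <= H p).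
Implicit Types (p q v x : V) (u : V -> R) (U : set V).

Let dH p : differentiable H p.
Proof. exact: smooth_differentiable sH _. Qed.

Lemma grad_min0 : grad H 0 = 0.
Proof.
apply/rowP => i; rewrite [LHS]mxE [RHS]mxE.
apply: (derive_at_min (diff_derivable (dH 0))) => y; by rewrite H0.
Qed.

Lemma strongly_convex_ge p : lam / 4 * sqnorm p <= H p.
Proof.
have := strongly_convex_tangent lam0 cH (diff_derivable (dH 0) : derivable H 0 p).
rewrite derive_grad // grad_min0 H0 add0r subr0.
by rewrite dot0v add0r.
Qed.

Lemma strongly_convex_gt0 p : p != 0 -> 0 < H p.
Proof.
move=> /sqnorm_gt0 p0; apply: lt_le_trans (strongly_convex_ge p).
by rewrite mulr_gt0 // divr_gt0.
Qed.

Lemma hess_posdef p v : v != 0 -> 0 < dotv (mxapp (hess H p) v) v.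
Proof.
move=> /sqnorm_gt0 v0; apply: lt_le_trans (hess_coercive p v lam0 sH cH).
by rewrite mulr_gt0 // divr_gt0.
Qed.

(** The tangent inequality at p is evaluated at the origin: a zero gradient would force H(p) <= H(0)
    = 0. *)
Lemma grad_neq0 p : p != 0 -> grad H p != 0.
Proof.
move=> p0; apply/eqP => g0.
have := strongly_convex_tangent lam0 cH (diff_derivable (dH p) : derivable H p (- p)).
rewrite derive_grad // g0 subrr H0 sub0r.
rewrite dot0v.
have := strongly_convex_gt0 p0; have := sqnorm_ge0 (- p).
have l4 : 0 < lam / 4 by rewrite divr_gt0.
rewrite add0r => /(mulr_ge0 (ltW l4)) a b c.
by have := le_trans a c; rewrite oppr_ge0 leNgt b.
Qed.

(** This is the denominator of [tauH]. With w = A^-1 q it equals <A w, w>, and w <> 0 because q <>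
    0. *)
Lemma dotv_invmx_gt0 p : p != 0 ->
  0 < dotv (mxapp (invmx (hess H p)) (grad H p)) (grad H p).
Proof.
move=> p0; have dA : \det (hess H p) != 0.
  by rewrite gt_eqF //; apply: posdef_det; exact: hess_posdef.
have := mxapp_invmx (grad H p) dA.
move: (grad_neq0 p0); set q := grad H p; set w := mxapp _ q => q0 wq.
rewrite dotvC -{1}wq; apply: hess_posdef.
by apply: contra q0 => /eqP w0; rewrite -wq w0 mxapp0.
Qed.

Lemma sqrt_grad_lipschitz U u : open U -> smooth_on U u ->
  locally_lipschitz_on U (fun y => Num.sqrt (H (grad u y))).
Proof.
move=> oU su x Ux.
have l0 := smooth_locally_lipschitz (smooth_derive (evec R 0) su) oU Ux.
have l1 := smooth_locally_lipschitz (smooth_derive (evec R 1) su) oU Ux.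
have [r [[r0 [bU [L0 L00 h0]]] [_ [L1 L10 h1]]]] :=
  @filter_ex _ _ (at_right_proper_filter 0) _ (filterI (filterI (nbhs_right_gt 0) l0) l1).
exists r; split=> //; split=> //.
have Lam0 : 0 <= Lam by apply: le_trans lamLam; exact: ltW.
have C0 : 0 <= Lam / 2 * (L0 ^+ 2 + L1 ^+ 2).
  by rewrite mulr_ge0 ?divr_ge0 ?addr_ge0 ?sqr_ge0.
(* Chosen so that Lam / 2 times the squared increment of Du is at most (M |y - z|)^2, as
   [sqrt_lipschitz] requires. *)
set M := Num.sqrt (Lam / 2 * (L0 ^+ 2 + L1 ^+ 2)).
exists M.
have half y z : ball x r y -> ball x r z ->
    Num.sqrt (H (grad u y)) <= Num.sqrt (H (grad u z)) + M * `|y - z|.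
  move=> xy xz; apply: (sqrt_lipschitz Lam0 _ CH Hge0).
    by rewrite mulr_ge0 ?sqrtr_ge0.
  rewrite exprMn sqr_sqrtr // -[leRHS]mulrA ler_wpM2l ?divr_ge0 // sqnormE mulrDl.
  have sq (a L n : R) : `|a| <= L * n -> a ^+ 2 <= L ^+ 2 * n ^+ 2.
    by move=> h; rewrite -exprMn -real_normK ?num_real // lerXn2r ?nnegrE // (le_trans _ h).
  have gc i t : grad u t 0 i = 'D_(evec R i) u t by rewrite [LHS]mxE.
  have c i : (grad u y - grad u z) 0 i = 'D_(evec R i) u y - 'D_(evec R i) u z.
    by rewrite -!gc [LHS]mxE; congr (_ + _); rewrite [LHS]mxE.
  by rewrite (c 0) (c 1); apply: lerD; apply: sq; [exact: h0|exact: h1].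
move=> y z xy xz; have := half y z xy xz; have := half z y xz xy.
rewrite (distrC z y) ler_norml; set a := Num.sqrt _; set b := Num.sqrt _.
move: (M * _) => m h1' h2'; apply/andP; split; lra.
Qed.

(** The root attains its minimum 0 at x, so its derivative vanishes there; it dominates every
    partial derivative of u, whose derivatives at x vanish in turn. *)
Lemma hess_eq0 U u x : smooth_on U u -> U x -> grad u x = 0 ->
  differentiable (fun y => Num.sqrt (H (grad u y))) x ->
  grad (fun y => Num.sqrt (H (grad u y))) x = 0 /\ hess u x = 0.
Proof.
move=> su Ux p0 ds; set s := fun y => _ in ds *.
have s0 : s x = 0 by rewrite /s p0 H0 sqrtr0.
have Ds v : 'D_v s x = 0.
  by apply: (derive_at_min (diff_derivable ds)) => y; rewrite s0 sqrtr_ge0.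
split; first by apply/rowP => i; rewrite [LHS]mxE [RHS]mxE.
(* From [strongly_convex_ge]: |Du|^2 <= (4 / lam) H(Du). *)
set C := Num.sqrt (4 / lam).
have C2 : C ^+ 2 = 4 / lam by rewrite sqr_sqrtr // divr_ge0 // ltW.
have dom j y : `|'D_(evec R j) u y| <= C * `|s y|.
  have sy : 0 <= s y by exact: sqrtr_ge0.
  rewrite (ger0_norm sy).
  rewrite -(@ler_pXn2r _ 2) ?nnegrE ?mulr_ge0 ?sqrtr_ge0 //.
  rewrite real_normK ?num_real // exprMn C2 sqr_sqrtr //.
  have h := strongly_convex_ge (grad u y).
  have e : sqnorm (grad u y) <= 4 / lam * H (grad u y).
    have l4 : 0 < lam / 4 by rewrite divr_gt0.
    by rewrite -(ler_pM2l l4) mulrA mulf_div [lam * 4]mulrC divff ?mul1r // gt_eqF // mulr_gt0.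
  apply: le_trans e; rewrite sqnormE.
  have G i : grad u y 0 i = 'D_(evec R i) u y by rewrite [LHS]mxE.
  have [->|->] : j = 0 \/ j = 1.
    by case: j => -[|[|//]] lti; [left|right]; exact/val_inj.
  - by rewrite (G 0) lerDl sqr_ge0.
  - by rewrite (G 1) lerDr sqr_ge0.
apply/matrixP => i j; rewrite [LHS]mxE [RHS]mxE; apply/eqP.
have du : differentiable ('D_(evec R j) u) x by exact: smooth_derive_differentiable su Ux.
have uj : 'D_(evec R j) u x = 0.
  by have /rowP/(_ j) := p0; rewrite [LHS]mxE [RHS]mxE.
have := derive_dominated (diff_derivable du : derivable _ _ (evec R i))
  (diff_derivable ds : derivable _ _ (evec R i)) uj s0 (dom j).
by rewrite Ds normr0 mulr0 normr_le0.
Qed.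

(** The equation replaces <B q, q> by - eps tr(A B), turning the mixed Cayley-Hamilton term into eps
    tr(A B)^2. Left undivided, the identity serves both the formula and the sign of det B. *)
Lemma det_hess_identity U u x (eps : R) : open U -> smooth_on U u -> U x ->
  AH H u x + eps * divDpH H u x = 0 ->
  - \det (hess u x) * \det (hess H (grad u x)) *
    dotv (mxapp (invmx (hess H (grad u x))) (grad H (grad u x))) (grad H (grad u x)) =
  dotv (mxapp (hess H (grad u x)) (mxapp (hess u x) (grad H (grad u x))))
    (mxapp (hess u x) (grad H (grad u x))) + eps * (divDpH H u x) ^+ 2.
Proof.
move=> oU su Ux; rewrite AH_dot => /eqP; rewrite addr_eq0 => /eqP e.
have dA : \det (hess H (grad u x)) != 0.
  by rewrite gt_eqF //; apply: posdef_det; exact: hess_posdef.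
rewrite (cayley_hamilton_dot _ dA (hess_sym 0 1 su oU Ux)) e.
by rewrite -(divDpH_trace sH su Ux); congr (_ + _); ring.
Qed.

End StronglyConvex.

Theorem theorem2p3 (R : realType) (H : 'rV[R]_2 -> R) (U : set 'rV[R]_2)
    (eps : R) (u : 'rV[R]_2 -> R) :
  smooth_on setT H -> H1' H -> H2 H ->
  domain U -> 0 < eps <= 1 -> smooth_on U u ->
  (forall x, U x -> AH H u x + eps * divDpH H u x = 0) ->
  locally_lipschitz_on U (fun y => Num.sqrt (H (grad u y))) /\
  (forall x, U x -> differentiable (fun y => Num.sqrt (H (grad u y))) x ->
     (- \det (hess u x)) * \det (hess H (grad u x)) =
       4 * tauH H (grad u x) *
         dotv (mxapp (hess H (grad u x)) (grad (fun y => Num.sqrt (H (grad u y))) x))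
              (grad (fun y => Num.sqrt (H (grad u y))) x)
       + tauH H (grad u x) *
         (if grad u x == 0 then 0
          else eps * (divDpH H u x) ^+ 2 / H (grad u x))) /\
  (forall x, U x -> 0 <= - \det (hess u x)).

Proof.
move=> sH [lam [Lam [lam0 [lamLam [cH CH]]]]] [H0 Hge0] [_ [oU _]] /andP[eps0 _] su eqn.
have dA x : 0 < \det (hess H (grad u x)).
  by apply: posdef_det; exact: hess_posdef sH lam0 cH _.
have qform0 p v : 0 <= dotv (mxapp (hess H p) v) v.
  by apply: le_trans (hess_coercive p v lam0 sH cH); rewrite mulr_ge0 ?sqnorm_ge0 ?divr_ge0 // ltW.
split; first exact: (sqrt_grad_lipschitz lam0 lamLam CH Hge0 oU su).
split=> x Ux; last first.
  have [p0|p0] := eqVneq (grad u x) 0.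
    rewrite oppr_ge0.
    apply: (@trace0_det_le0 _ (hess H (grad u x))).
    - exact: hess_posdef sH lam0 cH _.
    - exact: hess_sym su oU Ux.
    (* Since q = 0, the equation reduces to eps tr(A B) = 0. *)
    have q0 : grad H (grad u x) = 0 by rewrite p0 (grad_min0 sH H0 Hge0).
    have := eqn x Ux; rewrite AH_dot q0 dotvC dot0v add0r (divDpH_trace sH su Ux).
    by move/eqP; rewrite mulf_eq0 gt_eqF //= => /eqP.
  have := det_hess_identity sH lam0 cH oU su Ux (eqn x Ux).
  have w0 := dotv_invmx_gt0 sH lam0 cH H0 Hge0 p0.
  (* Multiplying by the positive factors det A and <A^-1 q, q> preserves the sign. *)
  move=> e; rewrite -(pmulr_lge0 _ (dA x)) -(pmulr_lge0 _ w0) e.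
  by rewrite addr_ge0 // mulr_ge0 ?sqr_ge0 // ltW.
move=> ds.
have [p0|p0] := eqVneq (grad u x) 0.
  (* The gradient of the root and B are both 0, and the quotient is 0 by convention, so both sides
     vanish. *)
  have [-> ->] := hess_eq0 sH lam0 cH H0 Hge0 su Ux p0 ds.
  have -> : \det (0 : 'M[R]_2) = 0 by rewrite det0.
  by rewrite dotvC dot0v oppr0 mul0r !mulr0 addr0.
have w0 := dotv_invmx_gt0 sH lam0 cH H0 Hge0 p0.
have := det_hess_identity sH lam0 cH oU su Ux (eqn x Ux).
(* Here B q = D[H(Du)] = 2 H^(1/2) D[H^(1/2)], so the quadratic form gains the factor 4 H. Division
   by <A^-1 q, q> then produces [tauH]. *)
rewrite -[mxapp (hess u x) _](etrans (grad_sqrt (fun y => Hge0 (grad u y)) ds)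
  (grad_comp_grad sH su Ux)).
rewrite quadratic_form_mul exprMn sqr_sqrtr // /tauH (negbTE p0).
have Hp := strongly_convex_gt0 sH lam0 cH H0 Hge0 p0.
move: (dotv _ _) w0 => w w0.
move: (dotv _ _) (_ * \det _) (H _) Hp => g d h Hp.
move: (divDpH _ _ _) => D e.
apply: (mulIf (lt0r_neq0 w0)); rewrite e.
by field; rewrite !lt0r_neq0.
Qed.
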